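(* Let $D$ be a locally linear division ring, and let $D'=[D^*,D^*]$ be the derived subgroup of its multiplicative group $D^*$. Then the center $Z(D')$ of the group $D'$ is a torsion group.
   Context: A division ring is centrally finite if it is a finite dimensional vector space over its center. A division ring is linear if it can be embedded in some centrally finite division ring. A division ring $D$ is locally linear if for every finite subset $S\subseteq D$ the division subring of $D$ generated by $S$ is linear. *)

(* Defs.v *)
From HB Require Import structures.
From mathcomp Require Import all_boot all_order all_algebra.
From mathcomp Require Import boolp classical_sets cardinality.

Set Implicit Arguments.
Unset Strict Implicit.
Unset Printing Implicit Defensive.

Import GRing.Theory.

Local Open Scope classical_set_scope.
Local Open Scope ring_scope.

HB.mixin Record UnitRing_isDivRing R of GRing.UnitRing R := {
  divringP : forall x : R, x != 0 -> x \is a GRing.unit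
}.

#[short(type="divRingType")]
HB.structure Definition DivRing :=
  {R of UnitRing_isDivRing R & GRing.UnitRing R}.

Lemma divr_unitE (D : divRingType) (x : D) : (x \is a GRing.unit) = (x != 0).
Proof.
apply/idP/idP; last exact: divringP.
by apply: contraTneq => ->; rewrite unitr0.
Qed.

Section Center.
Variable R : unitRingType.

Definition center_set : set R := [set x | forall y : R, x * y = y * x].

Definition center_pred : {pred R} := fun x => x \in center_set.

Lemma center_divring_closed : divring_closed center_pred.
Proof.
split; first by apply/mem_set => y; rewrite mul1r mulr1.
- by move=> x y /set_mem cx /set_mem cy; apply/mem_set => z;
    rewrite mulrBl mulrBr cx cy.
- move=> x y /set_mem cx /set_mem cy; apply/mem_set => z.
  have cV : y^-1 * z = z * y^-1 by apply/esym/commrV; rewrite /GRing.comm cy.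
  by rewrite -mulrA cV !mulrA cx.
Qed.

HB.instance Definition _ :=
  GRing.isDivringClosed.Build R center_pred center_divring_closed.

Record center := Center { center_val : R; _ : center_val \in center_pred }.

HB.instance Definition _ := [isSub for center_val].
HB.instance Definition _ := [Choice of center by <:].
HB.instance Definition _ := [SubChoice_isSubUnitRing of center by <:].

Lemma center_mulC : commutative (@GRing.mul center).
Proof.
by move=> [x cx] y; apply: val_inj; rewrite !rmorphM /=; exact: (set_mem cx).
Qed.

HB.instance Definition _ :=
  GRing.PzSemiRing_hasCommutativeMul.Build center center_mulC.

End Center.

Section CenterField.
Variable D : divRingType.

Lemma center_fieldP (x : center D) : x != 0 -> x \is a GRing.unit.
Proof.
move=> nz; have nzv : val x != 0.
  by rewrite -(inj_eq val_inj) rmorph0 in nz.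
have uv := divringP _ nzv.
have cV : (val x)^-1 \in @center_pred D by rewrite rpredV; exact: valP.
apply/unitrP; exists (Center cV).
by split; apply: val_inj; rewrite rmorphM rmorph1 /= ?mulVr ?mulrV.
Qed.

HB.instance Definition _ :=
  GRing.ComUnitRing_isField.Build (center D) center_fieldP.

End CenterField.

(* D, viewed as a vector space over its center *)
Definition over_center (D : divRingType) : Type := D.

Section OverCenter.
Variable D : divRingType.

HB.instance Definition _ := GRing.Zmodule.on (over_center D).

Definition center_scale (c : center D) (x : over_center D) : over_center D :=
  (val c : D) * (x : D).

Fact center_scaleA (a b : center D) (x : over_center D) :
  center_scale a (center_scale b x) = center_scale (a * b) x.
Proof. by rewrite /center_scale rmorphM mulrA. Qed.

Fact center_scale1 : left_id 1 center_scale.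
Proof. by move=> x; rewrite /center_scale rmorph1 mul1r. Qed.

Fact center_scaleDr : right_distributive center_scale +%R.
Proof. by move=> a x y; rewrite /center_scale mulrDr. Qed.

Fact center_scaleDl (x : over_center D) :
  {morph center_scale^~ x : a b / a + b}.
Proof. by move=> a b; rewrite /center_scale rmorphD mulrDl. Qed.

HB.instance Definition _ := GRing.Zmodule_isLmodule.Build (center D)
  (over_center D) center_scaleA center_scale1 center_scaleDr center_scaleDl.

End OverCenter.

Definition centrally_finite (D : divRingType) : Prop :=
  exists (n : nat) (f : {linear over_center D -> 'rV[center D]_n}),
    bijective f.

Definition linear_divring (D : divRingType) : Prop :=
  exists2 E : divRingType,
    centrally_finite E & exists f : {rmorphism D -> E}, injective f.

Section Generated.
Variables (D : divRingType) (S : set D).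

Definition divgen_set : set D :=
  smallest [set K : set D | divring_closed [in K]] S.

Definition divgen_pred : {pred D} := fun x => x \in divgen_set.

Lemma divgen_closed : divring_closed divgen_pred.
Proof.
split.
- by apply/mem_set => K [[K1 _ _] _]; exact: set_mem.
- move=> x y /set_mem Kx /set_mem Ky; apply/mem_set => K KP.
  have [[_ KB _] _] := KP.
  by apply/set_mem/KB; apply/mem_set; [exact: Kx | exact: Ky].
- move=> x y /set_mem Kx /set_mem Ky; apply/mem_set => K KP.
  have [[_ _ KV] _] := KP.
  by apply/set_mem/KV; apply/mem_set; [exact: Kx | exact: Ky].
Qed.

HB.instance Definition _ :=
  GRing.isDivringClosed.Build D divgen_pred divgen_closed.

Record divgen := Divgen { divgen_val : D; _ : divgen_val \in divgen_pred }.

HB.instance Definition _ := [isSub for divgen_val].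
HB.instance Definition _ := [Choice of divgen by <:].
HB.instance Definition _ := [SubChoice_isSubUnitRing of divgen by <:].

Lemma divgen_divringP (x : divgen) : x != 0 -> x \is a GRing.unit.
Proof.
move=> nz; have nzv : val x != 0.
  by rewrite -(inj_eq val_inj) rmorph0 in nz.
have uv := divringP _ nzv.
have gV : (val x)^-1 \in divgen_pred by rewrite rpredV; exact: valP.
apply/unitrP; exists (Divgen gV).
by split; apply: val_inj; rewrite rmorphM rmorph1 /= ?mulVr ?mulrV.
Qed.

HB.instance Definition _ := UnitRing_isDivRing.Build divgen divgen_divringP.

End Generated.

Definition locally_linear (D : divRingType) : Prop :=
  forall S : set D, finite_set S -> linear_divring (divgen S).

Section Units.
Variable R : unitRingType.

Record units := Units { units_val : R; _ : units_val \is a GRing.unit }.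

HB.instance Definition _ := [isSub for units_val].
HB.instance Definition _ := [Choice of units by <:].

Definition units_one : units := Units (@unitr1 R).

Fact units_mul_subproof (x y : units) : val x * val y \is a GRing.unit.
Proof. by rewrite unitrMl ?(valP x) ?(valP y). Qed.

Definition units_mul (x y : units) : units := Units (units_mul_subproof x y).

Fact units_inv_subproof (x : units) : (val x)^-1 \is a GRing.unit.
Proof. by rewrite unitrV; exact: valP. Qed.

Definition units_inv (x : units) : units := Units (units_inv_subproof x).

Fact units_mulA : associative units_mul.
Proof. by move=> x y z; apply: val_inj; rewrite /= mulrA. Qed.

Fact units_mul1 : left_id units_one units_mul.
Proof. by move=> x; apply: val_inj; rewrite /= mul1r. Qed.

Fact units_mulr1 : right_id units_one units_mul.
Proof. by move=> x; apply: val_inj; rewrite /= mulr1. Qed.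

Fact units_mulV : left_inverse units_one units_inv units_mul.
Proof. by move=> x; apply: val_inj; rewrite /= mulVr ?(valP x). Qed.

Fact units_mulrV : right_inverse units_one units_inv units_mul.
Proof. by move=> x; apply: val_inj; rewrite /= mulrV ?(valP x). Qed.

HB.instance Definition _ := isGroup.Build units
  units_mulA units_mul1 units_mulr1 units_mulV units_mulrV.

End Units.

Section GroupNotions.
Variable G : groupType.
Local Open Scope group_scope.

Definition derived_subgroup : set G :=
  smallest [set H : set G | group_closed [in H]]
           [set z | exists x y : G, z = [~ x, y]].

Definition group_center (H : set G) : set G :=
  [set x | H x /\ forall y, H y -> commute x y].

Definition torsion (H : set G) : Prop :=
  forall x, H x -> exists2 n : nat, (0 < n)%N & x ^+ n = 1.

End GroupNotions.
Arguments derived_subgroup G : clear implicits.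

(* Main.v *)
(* An element [x] of [D'] commuting with all commutators is central in [D]. It
   is a product of commutators of finitely many elements, which generate a
   division ring embedded in some [E] of finite dimension over its center [F];
   so [x], in [E], is a product of commutators of elements of its centralizer.
   Let [A] be the matrix over [F] of multiplication by [x] on [E]. Since [E] is
   a division ring, the minimal polynomial [p] of [A] is irreducible. Let [z] be
   a root of [p] in an extension of [F]. The centralizer of [x] acts on the
   [z]-eigenspace of [A], of dimension [r] say; the determinant of the action of
   [x] is both [z ^+ r] and [1]. So [p] divides ['X^r - 1] and [x ^+ r = 1]. *)
Require Import Defs.
From HB Require Import structures.
From mathcomp Require Import all_boot all_algebra.
From mathcomp Require Import fieldext classical_sets cardinality.

Set Implicit Arguments.
Unset Strict Implicit.
Unset Printing Implicit Defensive.

Import GRing.Theory.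

Local Open Scope ring_scope.

(** * Commutator products and matrices over a field *)

(** The bracketing is that of the group commutator, so that [[~ x, y]] in [units R] has value
    [commr (val x) (val y)] by conversion. *)
Definition commr (R : unitRingType) (x y : R) : R := x^-1 * (y^-1 * (x * y)).

Lemma comm_commr (R : unitRingType) (a x y : R) :
  GRing.comm a x -> GRing.comm a y -> GRing.comm a (commr x y).
Proof. by move=> ax ay; do !apply: commrM => //; apply: commrV. Qed.

(** Unlike centrality, this property passes to the image under an embedding into a larger ring. *)
Definition derived_in_centralizer (R : unitRingType) (a : R) : Prop :=
  exists2 l : seq (R * R),
    forall p, p \in l ->
      [/\ p.1 \is a GRing.unit, p.2 \is a GRing.unit,
          GRing.comm a p.1 & GRing.comm a p.2]
    & a = \prod_(p <- l) commr p.1 p.2.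

Lemma derived_in_centralizer_rmorph (R S : unitRingType)
    (f : {rmorphism R -> S}) (a : R) :
  derived_in_centralizer a -> derived_in_centralizer (f a).
Proof.
move=> [l Hl defa]; exists [seq (f p.1, f p.2) | p <- l].
  move=> _ /mapP[p pl ->] /=; have [u1 u2 c1 c2] := Hl p pl.
  by split; rewrite ?(rmorph_unit f) // /GRing.comm -!(rmorphM f) ?c1 ?c2.
rewrite [in LHS]defa rmorph_prod big_map; apply: eq_big_seq => p pl.
by have [u1 u2 _ _] := Hl p pl; rewrite /commr !rmorphM !rmorphV.
Qed.

(* Matrices commuting with [A] act on the eigenspace; the determinant of this
   action is multiplicative, so it is [1] on [A], where it is a power of [z]. *)
Lemma derived_in_centralizer_eigenvalue (F : fieldType) (n : nat)
    (A : 'M[F]_n.+1) (z : F) :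
  derived_in_centralizer A -> eigenvalue A z ->
  exists2 r : nat, (0 < r)%N & z ^+ r = 1.
Proof.
move=> [l Hl defA] Az; set V := row_base (eigenspace A z).
have Vfree : row_free V by exact: row_base_free.
have stabV M : GRing.comm A M -> stablemx V M.
  by move=> AM; rewrite stablemx_row_base comm_mx_stable_eigenspace.
pose delta M := \det (conjmx V M).
have delta1 : delta 1 = 1 by rewrite /delta conjmx_scalar ?det1.
have deltaM M N : GRing.comm A M -> GRing.comm A N ->
    delta (M * N) = delta M * delta N.
  by move=> AM AN; rewrite /delta -det_mulmx -conjmxM ?inE ?stabV.
have deltaA : delta A = z ^+ \rank (eigenspace A z).
  by rewrite /delta (@conjmx_eigenvalue _ _ _ z) ?det_scalar ?eq_row_base.
exists (\rank (eigenspace A z)); first by rewrite lt0n mxrank_eq0.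
rewrite -deltaA [X in delta X]defA {defA deltaA}.
(* The induction carries commutation with [A] along, since [deltaM] asks it of both factors. *)
suff [] : GRing.comm A (\prod_(p <- l) commr p.1 p.2)
    /\ delta (\prod_(p <- l) commr p.1 p.2) = 1 by [].
elim: l Hl => [|p l IH] Hl; first by rewrite big_nil; split=> //; exact: commr1.
have [q ql|cA dA] := IH; first by apply: Hl; rewrite inE ql orbT.
have [u1 u2 c1 c2] := Hl p (mem_head _ _).
rewrite big_cons; split; first by apply: commrM => //; exact: comm_commr.
have v1 := commrV c1; have v2 := commrV c2.
rewrite deltaM ?dA ?mulr1 //; last exact: comm_commr.
rewrite /commr 3?deltaM //; try by do !apply: commrM.
(* The values of [delta] lie in the commutative [F], so the factors of a commutator cancel in
   pairs. *)
rewrite [delta p.2^-1 * _]mulrCA -deltaM // mulVr // delta1 mulr1.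
by rewrite -deltaM // mulVr.
Qed.

Lemma derived_in_centralizer_mx_torsion (F : fieldType) (n : nat)
    (A : 'M[F]_n.+1) :
  irreducible_poly (mxminpoly A) -> derived_in_centralizer A ->
  exists2 r : nat, (0 < r)%N & A ^+ r = 1.
Proof.
move=> irr derA.
have [L _ [z rz _]] := irredp_FAdjoin irr.
have [r r0 zr] : exists2 r : nat, (0 < r)%N & z ^+ r = 1.
  have derLA := derived_in_centralizer_rmorph (map_mx (in_alg L)) derA.
  apply: derived_in_centralizer_eigenvalue derLA _.
  by rewrite eigenvalue_root_char -root_mxminpoly mxminpoly_map.
exists r => //.
have : mxminpoly A %| 'X^r - 1.
  (* By irreducibility the alternative to divisibility is coprimality, which the common root [z] in
     [L] excludes. *)
  have [cop|ncop] := boolP (coprimep (mxminpoly A) ('X^r - 1)); last first.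
    have gp := irr.2 _ ncop (dvdp_gcdl _ _).
    by rewrite -(eqp_dvdl _ gp) dvdp_gcdr.
  rewrite -(coprimep_map (in_alg L)) in cop.
  have := coprimep_root cop rz.
  by rewrite rmorphB rmorph1 /= map_polyXn !hornerE zr subrr eqxx.
move/mxminpoly_minP; rewrite rmorphB rmorphXn rmorph1 /= horner_mx_X.
by move/eqP; rewrite subr_eq0 => /eqP.
Qed.

(** * Right multiplications as matrices over the center *)

Section RegularRepresentation.
Variables (E : divRingType) (n : nat).
Variable f : {linear over_center E -> 'rV[center E]_n.+1}.
Variable g : 'rV[center E]_n.+1 -> over_center E.
Hypotheses (fK : cancel f g) (gK : cancel g f).

Definition coord_mulr (a : E) (u : 'rV[center E]_n.+1) : 'rV[center E]_n.+1 :=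
  f ((g u : E) * a : E).

Fact coord_mulr_linear (a : E) : linear (coord_mulr a).
Proof.
move=> c u v; rewrite /coord_mulr.
have -> : g (c *: u + v) = c *: g u + g v.
  by apply: (can_inj fK); rewrite gK linearP !gK.
by rewrite -linearP; congr (f _); rewrite mulrDl -mulrA.
Qed.

HB.instance Definition _ (a : E) :=
  GRing.isLinear.Build (center E) 'rV[center E]_n.+1 'rV[center E]_n.+1 _
    (coord_mulr a) (coord_mulr_linear a).

(* Row vectors turn right multiplication into a homomorphism. *)
Definition regular_mx (a : E) : 'M[center E]_n.+1 := lin1_mx (coord_mulr a).

Lemma mul_regular_mx (u : 'rV[center E]_n.+1) (a : E) :
  u *m regular_mx a = f ((g u : E) * a : E).
Proof. by rewrite mul_rV_lin1. Qed.

Fact regular_mx_zmod_morphism : zmod_morphism regular_mx.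
Proof.
move=> a b; apply/row_matrixP => i; rewrite !rowE mulmxBr !mul_regular_mx.
by rewrite -linearB mulrBr.
Qed.

Fact regular_mx_monoid_morphism : monoid_morphism regular_mx.
Proof.
split=> [|a b]; apply/row_matrixP => i; rewrite !rowE.
  by rewrite mulmx1 mul_regular_mx mulr1 gK.
by rewrite mulmxA !mul_regular_mx fK mulrA.
Qed.

HB.instance Definition _ := GRing.isZmodMorphism.Build E 'M[center E]_n.+1
  regular_mx regular_mx_zmod_morphism.
HB.instance Definition _ := GRing.isMonoidMorphism.Build E 'M[center E]_n.+1
  regular_mx regular_mx_monoid_morphism.

Lemma regular_mx_scale (c : center E) : regular_mx (val c) = c%:M.
Proof.
apply/row_matrixP => i; rewrite !rowE mul_regular_mx mul_mx_scalar.
rewrite -[in RHS](gK (delta_mx 0 i)) -linearZ; congr (f _).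
by rewrite /= [RHS](set_mem (valP c)).
Qed.

Lemma regular_mx_inj : injective regular_mx.
Proof.
move=> a b /(congr1 (mulmx (f (1 : E)))); rewrite !mul_regular_mx fK !mul1r.
exact: (can_inj fK).
Qed.

(** The image of [regular_mx] is a subring containing the scalar matrices. *)
Lemma horner_regular_mx (a : E) (p : {poly center E}) :
  exists b : E, horner_mx (regular_mx a) p = regular_mx b.
Proof.
elim/poly_ind: p => [|p c [b pb]]; first by exists 0; rewrite !rmorph0.
exists (b * a + val c).
rewrite rmorphD !rmorphM /= horner_mx_X horner_mx_C pb.
by rewrite rmorphD rmorphM /= regular_mx_scale.
Qed.

(** If the minimal polynomial is [r * q], evaluation at the matrix gives [d * b = 0] in [E], which
    has no zero divisors. For [b] nonzero, the minimal polynomial would divide [r], which is of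
    smaller degree. *)
Lemma irreducible_mxminpoly_regular (a : E) :
  irreducible_poly (mxminpoly (regular_mx a)).
Proof.
split=> [|q q1 qA]; first by rewrite size_mxminpoly ltnS mxminpoly_nonconstant.
have pn0 : mxminpoly (regular_mx a) != 0 by rewrite monic_neq0 ?mxminpoly_monic.
rewrite /eqp qA /=; apply/mxminpoly_minP.
have [b qb] := horner_regular_mx a q; rewrite qb.
have [->|b0] := eqVneq b 0; first exact: rmorph0.
have /dvdpP[r defp] := qA.
have [d rd] := horner_regular_mx a r.
have : regular_mx (d * b) = 0.
  by rewrite rmorphM /= -rd -qb -rmorphM /= -defp mx_root_minpoly.
rewrite -[0 in RHS](rmorph0 regular_mx) => /regular_mx_inj /eqP.
have ub := divringP _ b0; rewrite (mulIr_eq0 _ (mulIr ub)) => /eqP d0.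
have r0 : r != 0 by apply: contraNneq pn0 => r0; rewrite defp r0 mul0r.
have pr : mxminpoly (regular_mx a) %| r.
  by apply/mxminpoly_minP; rewrite rd d0 rmorph0.
have q0 : q != 0 by apply: contraNneq pn0 => q0; rewrite defp q0 mulr0.
move: (dvdp_leq r0 pr); rewrite defp size_mul //.
have : (0 < size q)%N by rewrite size_poly_gt0.
by case: (size q) q1 => [|[|k]] // _ _; rewrite !addnS /= ltnNge leq_addr.
Qed.

Lemma derived_in_centralizer_torsion (a : E) :
  derived_in_centralizer a -> exists2 r : nat, (0 < r)%N & a ^+ r = 1.
Proof.
move=> dera; have [r r0 ar] := derived_in_centralizer_mx_torsion
  (irreducible_mxminpoly_regular a)
  (derived_in_centralizer_rmorph regular_mx dera).
exists r => //; apply: regular_mx_inj.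
by rewrite rmorphXn /= ar rmorph1.
Qed.

End RegularRepresentation.

Lemma centrally_finite_derived_torsion (E : divRingType) (a : E) :
  centrally_finite E -> derived_in_centralizer a ->
  exists2 r : nat, (0 < r)%N & a ^+ r = 1.
Proof.
move=> [[|n] [f [g fK gK]]]; last exact: derived_in_centralizer_torsion fK gK _.
(* In dimension 0, all elements have the same coordinates. *)
have /eqP : (1 : E) = 0 by apply: (can_inj fK); apply/rowP => -[].
by rewrite oner_eq0.
Qed.

(* If conjugation by [y] and by [y + 1] both send [x] into its own centralizer
   [C], say to [a] and [b], then [y (a - b) = b - x], so [y] lies in [C] unless
   [a = b = x]. *)
Lemma central_of_comm_commr (D : divRingType) (x : D) :
  x != 0 -> (forall y, y != 0 -> GRing.comm x (commr x y)) ->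
  forall y, GRing.comm x y.
Proof.
move=> x0 Hx y; have ux := divringP _ x0.
have conj_comm w : w != 0 -> exists2 a, x * w = w * a & GRing.comm x a.
  (* This is the conjugate [w^-1 * x * w]. *)
  move=> w0; exists (x * commr x w).
    by rewrite /commr mulVKr // mulVKr // divringP.
  by apply: commrM => //; exact: Hx.
have [->|y0] := eqVneq y 0; first exact: commr0.
have [y1|y1] := eqVneq (y + 1) 0.
  by rewrite -[y](addrK 1) y1 sub0r; apply: commrN1.
have [a xya ca] := conj_comm _ y0; have [b xyb cb] := conj_comm _ y1.
have E : y * (a - b) = b - x.
  apply/eqP; rewrite mulrBr -xya subr_eq addrAC eq_sym subr_eq.
  by rewrite -[X in _ == _ + X]mulr1 -mulrDr xyb mulrDl mul1r addrC.
have [ab|ab] := eqVneq a b.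
  move/eqP: E; rewrite ab subrr mulr0 eq_sym subr_eq0 => /eqP bx.
  by rewrite /GRing.comm xya ab bx.
have uab : a - b \is a GRing.unit by rewrite divringP // subr_eq0.
rewrite -(mulrK uab y) E.
by apply: commrM; [apply: commrB | apply: commrV; apply: commrB].
Qed.

(** Inversion swaps the two entries of a commutator and reverses products. Invertibility is proved
    along with it because [invrM] requires it. *)
Lemma prod_commrV (R : unitRingType) (l : seq (R * R)) :
  (forall p, p \in l -> p.1 \is a GRing.unit /\ p.2 \is a GRing.unit) ->
  (\prod_(p <- l) commr p.1 p.2)^-1
    = \prod_(p <- rev [seq (p.2, p.1) | p <- l]) commr p.1 p.2
  /\ \prod_(p <- l) commr p.1 p.2 \is a GRing.unit.
Proof.
elim: l => [|p l IH] Hl; first by rewrite !big_nil invr1 unitr1.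
have [q ql|IHV IHu] := IH; first by apply: Hl; rewrite inE ql orbT.
have [u1 u2] := Hl p (mem_head _ _).
have u : commr p.1 p.2 \is a GRing.unit by rewrite /commr !unitrMr ?unitrV.
rewrite /= rev_cons -cats1 big_cat big_seq1 big_cons unitrMr // invrM // IHV.
split=> //=; congr (_ * _).
by rewrite /commr !invrM ?unitrMr ?unitrV // !invrK !mulrA.
Qed.

(** Such products form a group containing all commutators, hence containing the smallest one. *)
Lemma derived_subgroup_prod_commr (R : unitRingType) (z : units R) :
  derived_subgroup (units R) z ->
  exists2 l : seq (R * R),
    forall p, p \in l -> p.1 \is a GRing.unit /\ p.2 \is a GRing.unit
    & val z = \prod_(p <- l) commr p.1 p.2.
Proof.
pose H : set (units R) := [set w | exists2 l : seq (R * R),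
    forall p, p \in l -> p.1 \is a GRing.unit /\ p.2 \is a GRing.unit
    & val w = \prod_(p <- l) commr p.1 p.2]%classic.
move=> z_der; apply: (z_der H); split; last first.
  move=> _ [x [y ->]]; exists [:: (val x, val y)]; last by rewrite big_seq1.
  by move=> p; rewrite inE => /eqP -> /=; split; exact: valP.
split=> [|v w /set_mem[l Hl vE] /set_mem[m Hm wE]]; apply/mem_set.
  by exists [::] => //; rewrite big_nil.
have [mV mu] := prod_commrV Hm.
exists (l ++ rev [seq (p.2, p.1) | p <- m]).
  move=> p; rewrite mem_cat mem_rev => /orP[/Hl //|/mapP[q qm ->]].
  by have [] := Hm q qm.
by rewrite big_cat /= -mV -vE -wE.
Qed.

Theorem theorem3p1 (D : divRingType) (hD : locally_linear D) :
  torsion (group_center (derived_subgroup (units D))).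
Proof.
move=> x [x_der x_cent].
have x_central : forall y : D, GRing.comm (val x) y.
  apply: central_of_comm_commr => [|y y0].
    by rewrite -divr_unitE; exact: valP.
  have yu : y \is a GRing.unit by rewrite divringP.
  have /x_cent/(congr1 val) // : derived_subgroup (units D) [~ x, Units yu]%g.
  by move=> K [_]; apply; exists x, (Units yu).
have [l Hl xE] := derived_subgroup_prod_commr x_der.
pose S : set D := [set` unzip1 l ++ unzip2 l]%classic.
have [|E finE [phi phi_inj]] := hD S; first exact: finite_seq.
have memS (y : D) : y \in unzip1 l ++ unzip2 l -> y \in divgen_pred S.
  by move=> yl; apply/mem_set => K [_]; apply.
have mem1 q : q \in l -> q.1 \in unzip1 l ++ unzip2 l.
  by move=> ql; rewrite mem_cat (map_f (@fst D D) ql).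
have mem2 q : q \in l -> q.2 \in unzip1 l ++ unzip2 l.
  by move=> ql; rewrite mem_cat (map_f (@snd D D) ql) orbT.
have liftK (y : D) :
    y \in unzip1 l ++ unzip2 l -> val (insubd (0 : divgen S) y) = y.
  by move=> yl; rewrite insubdK //; exact: memS.
(* The default [0] is never taken: the entries of [l] all lie in [divgen S]. *)
pose l' :=
  [seq (insubd (0 : divgen S) p.1, insubd (0 : divgen S) p.2) | p <- l].
have unit_lift (y : divgen S) : val y \is a GRing.unit -> y \is a GRing.unit.
  by rewrite !divr_unitE; apply: contraNneq => ->; rewrite rmorph0.
pose x' := \prod_(p <- l') commr p.1 p.2.
have Hl' p : p \in l' -> p.1 \is a GRing.unit /\ p.2 \is a GRing.unit.
  move=> /mapP[q ql ->] /=; have [u1 u2] := Hl q ql.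
  by split; apply: unit_lift; rewrite liftK ?mem1 ?mem2.
have x'E : val x' = val x.
  rewrite xE rmorph_prod big_map; apply: eq_big_seq => p pl.
  have [u1 u2] := Hl' _ (map_f _ pl).
  by rewrite /commr !rmorphM !rmorphV //= !liftK ?mem1 ?mem2.
have x'_central (y : divgen S) : GRing.comm x' y.
  by apply: val_inj; rewrite !rmorphM /= x'E; exact: x_central.
(* Centrality of [x'] makes it commute with every entry of [l']. *)
have x'_der : derived_in_centralizer x'.
  by exists l' => // p pl; have [] := Hl' p pl; split.
have [r r0 xr] := centrally_finite_derived_torsion finE
  (derived_in_centralizer_rmorph phi x'_der).
exists r => //; apply: val_inj.
have x'r : x' ^+ r = 1 by apply: phi_inj; rewrite rmorphXn xr rmorph1.
have valX k : val (x ^+ k)%g = val x ^+ k.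
  by elim: k => [|k IH] //; rewrite expgS exprS -IH.
by rewrite valX -x'E -rmorphXn x'r rmorph1.
Qed.
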